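(* Let $\mathcal{Q}=(Q,\&)$ be a quantale and let $\Phi$ be a class of weights. For each map $f:A\to B$ between $\mathcal{Q}$-ordered sets, the following are equivalent: (1) $f:A\to B$ is $\Phi$-cocontinuous. (2) For each $\Phi$-closed fuzzy set $\phi$ of $B$, $\phi\circ f$ is a $\Phi$-closed fuzzy set of $A$.
   Context: A quantale $\mathcal{Q}=(Q,\&)$ is always assumed integral and commutative: $Q$ is a complete lattice (bottom $0$, top $1$) and $\&$ is a commutative associative operation on $Q$ with unit $1$ that distributes over arbitrary joins. Its implication $\to$ is defined by $p\&q\le r\iff q\le p\to r$. A $\mathcal{Q}$-ordered set is a set $A$ with a map $A(-,-):A\times A\to Q$ such that $A(x,x)=1$ and $A(y,z)\&A(x,y)\le A(x,z)$ for all $x,y,z\in A$. A map $f:A\to B$ is $\mathcal{Q}$-order preserving if $A(x,y)\le B(f(x),f(y))$ for all $x,y$. A fuzzy lower set of $A$ is a map $\phi:A\to Q$ with $\phi(y)\&A(x,y)\le\phi(x)$ for all $x,y$. $\mathrm{sub}_A(\phi_1,\phi_2)=\bigwedge_{x\in A}(\phi_1(x)\to\phi_2(x))$. For $f:A\to B$ $\mathcal{Q}$-order preserving and $\phi$ a fuzzy lower set of $A$, $f^{\to}(\phi)(y)=\bigvee_{x\in A}\phi(x)\&B(y,f(x))$. A class of weights $\Phi$ assigns to each $\mathcal{Q}$-ordered set $A$ a set $\Phi(A)$ of fuzzy lower sets of $A$ ($\mathcal{Q}$-ordered by $\mathrm{sub}_A$) such that $A(-,a)\in\Phi(A)$ for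 all $a\in A$, and $f^{\to}(\phi)\in\Phi(B)$ whenever $\phi\in\Phi(A)$ and $f:A\to B$ is $\mathcal{Q}$-order preserving. A supremum of a fuzzy lower set $\phi$ of $A$ is an element $\sup\phi\in A$ with $A(\sup\phi,x)=\mathrm{sub}_A(\phi,A(-,x))$ for all $x\in A$ (unique up to isomorphism, where $x,y$ are isomorphic if $A(x,y)=A(y,x)=1$). A map $f:A\to B$ is $\Phi$-cocontinuous if it is $\mathcal{Q}$-order preserving and, for all $\phi\in\Phi(A)$, whenever $\sup\phi$ exists, $f(\sup\phi)$ is a supremum of $f^{\to}(\phi)$. A map $\lambda:A\to Q$ is a $\Phi$-closed fuzzy set of $A$ if it is a fuzzy lower set and $\mathrm{sub}_A(\phi,\lambda)\le\lambda(\sup\phi)$ for all $\phi\in\Phi(A)$ for which $\sup\phi$ exists. *)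

(* Defs.v *)
From HB Require Import structures.
From mathcomp Require Import all_boot all_order.
From mathcomp Require Import boolp classical_sets.
Set Implicit Arguments.
Unset Strict Implicit.
Unset Printing Implicit Defensive.
Import Order.TTheory.
Local Open Scope order_scope.
Local Open Scope classical_set_scope.

Reserved Notation "p ⊗ q" (at level 40, left associativity).
Reserved Notation "p ⇒ q" (at level 41, right associativity).

(* The joins [qjoin S] range over all subsets, including the empty one. *)
HB.mixin Record isQuantale d (Q : Type) of Order.TBLattice d Q := {
  qjoin : set Q -> Q;
  qjoin_isLub : forall S : set Q, isLub S (qjoin S);
  qmul : Q -> Q -> Q;
  qmulA : associative qmul;
  qmulC : commutative qmul;
  qmul1 : forall p : Q, qmul p \top = p;
  qmul_joinr : forall (p : Q) (S : set Q),
    qmul p (qjoin S) = qjoin [set qmul p q | q in S]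
}.

#[short(type="quantaleType")]
HB.structure Definition Quantale d :=
  { Q of isQuantale d Q & Order.TBLattice d Q }.

Notation "p ⊗ q" := (qmul p q) : order_scope.

Section QuantaleTheory.
Context {d : Order.disp_t} {Q : quantaleType d}.
Implicit Types (p q r : Q) (S : set Q).

Definition qmeet S : Q := qjoin (lbound S).

Lemma qmeet_infimum S : infimums S (qmeet S).
Proof.
have [ubS leS] := qjoin_isLub (lbound S); split=> x Sx.
- by apply: leS => y; apply.
- exact: ubS.
Qed.

Definition qimp p r : Q := qjoin [set q | p ⊗ q <= r].

Lemma qmul_ler p q1 q2 : q1 <= q2 -> p ⊗ q1 <= p ⊗ q2.
Proof.
move=> le12; have -> : q2 = qjoin [set q1; q2].
  have [ub le] := qjoin_isLub [set q1; q2]; apply/le_anti/andP; split.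
  - by apply: ub; right.
  - by apply: le => x [] ->.
rewrite qmul_joinr; have [ub _] := qjoin_isLub [set p ⊗ q | q in [set q1; q2]].
by apply: ub; exists q1 => //; left.
Qed.

Lemma qimpP p q r : (p ⊗ q <= r) <-> (q <= qimp p r).
Proof.
have [ub _] := qjoin_isLub [set q | p ⊗ q <= r].
split=> [|le_q]; first exact: ub.
apply: le_trans (qmul_ler p le_q) _; rewrite /qimp qmul_joinr.
have [_ le] := qjoin_isLub [set p ⊗ q | q in [set q | p ⊗ q <= r]].
by apply: le => _ [s /= le_s <-].
Qed.

End QuantaleTheory.

Notation "p ⇒ r" := (qimp p r) : order_scope.

HB.mixin Record isQOrdered d (Q : quantaleType d) (A : Type) := {
  qhom : A -> A -> Q;
  qhom_refl : forall x : A, qhom x x = \top;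
  qhom_trans : forall x y z : A, qhom y z ⊗ qhom x y <= qhom x z
}.

#[short(type="qorderedType")]
HB.structure Definition QOrdered d (Q : quantaleType d) :=
  { A of isQOrdered d Q A }.

Section QOrderedSets.
Context {d : Order.disp_t} {Q : quantaleType d}.
Implicit Types A B : qorderedType Q.

Definition q_order_preserving A B (f : A -> B) : Prop :=
  forall x y : A, qhom x y <= qhom (f x) (f y) :> Q.

Definition fuzzy_lower A (phi : A -> Q) : Prop :=
  forall x y : A, phi y ⊗ qhom x y <= phi x.

Definition fuzzy_sub A (phi1 phi2 : A -> Q) : Q :=
  qmeet (range (fun x : A => phi1 x ⇒ phi2 x)).

Definition fuzzy_image A B (f : A -> B) (phi : A -> Q) : B -> Q :=
  fun y => qjoin (range (fun x : A => phi x ⊗ qhom y (f x))).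

(* Suprema are unique only up to isomorphism, hence a relation. *)
Definition is_supremum A (phi : A -> Q) (s : A) : Prop :=
  forall x : A, qhom s x = fuzzy_sub phi (fun y => qhom y x).

End QOrderedSets.

Record weightClass d (Q : quantaleType d) := WeightClass {
  weights :> forall A : qorderedType Q, set (A -> Q);
  weights_lower : forall (A : qorderedType Q) (phi : A -> Q),
    weights phi -> fuzzy_lower phi;
  weights_representable : forall (A : qorderedType Q) (a : A),
    weights (fun x : A => qhom x a);
  weights_image : forall (A B : qorderedType Q) (f : A -> B) (phi : A -> Q),
    q_order_preserving f -> weights phi -> weights (fuzzy_image f phi)
}.

Section Weights.
Context {d : Order.disp_t} {Q : quantaleType d} (Phi : weightClass Q).
Implicit Types A B : qorderedType Q.

Definition cocontinuous A B (f : A -> B) : Prop :=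
  q_order_preserving f /\
  forall (phi : A -> Q) (s : A), Phi A phi -> is_supremum phi s ->
    is_supremum (fuzzy_image f phi) (f s).

Definition closed_fuzzy A (lambda : A -> Q) : Prop :=
  fuzzy_lower lambda /\
  forall (phi : A -> Q) (s : A), Phi A phi -> is_supremum phi s ->
    fuzzy_sub phi lambda <= lambda s.

End Weights.

(* Main.v *)
Require Import Defs.
From mathcomp Require Import all_boot all_order.
From mathcomp Require Import boolp classical_sets.

(** The argument rests on the adjunction between direct image and
    precomposition: for a fuzzy lower set [psi] of the codomain,
    [sub_A(phi, psi \o f) = sub_B(f^->(phi), psi)] ([fuzzy_sub_image]).

    If [f] is cocontinuous, then [f s] is a supremum of [f^->(phi)] whenever
    [s] is one of [phi], so the closedness inequality for [psi] at the weight
    [f^->(phi)] is, read through the adjunction, the closedness inequality for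
    [psi \o f] at [phi].

    Conversely, the representable lower sets [B(-, b)] are closed for every
    class of weights ([closed_fuzzy_representable]), and they suffice as test
    objects.  That [B(-, f y) \o f] is a lower set gives the inequality
    [A(x, y) <= B(f x, f y)], by evaluating at [f y], where the representable
    takes the value [1].  That [B(-, b) \o f] is closed gives
    [sub_B(f^->(phi), B(-, b)) <= B(f s, b)]; the opposite inequality only
    says that [f s] is an upper bound of [f^->(phi)], which holds for every
    order preserving map ([supremum_image_ub]). *)

Set Implicit Arguments.
Unset Strict Implicit.
Unset Printing Implicit Defensive.
Import Order.TTheory.
Local Open Scope order_scope.
Local Open Scope classical_set_scope.

Section Quantale.
Context {d : Order.disp_t} {Q : quantaleType d}.
Implicit Types (p q r : Q) (S : set Q).

Lemma qmul_lel p q1 q2 : q1 <= q2 -> q1 ⊗ p <= q2 ⊗ p.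
Proof. by move=> le12; rewrite ![_ ⊗ p]qmulC; apply: qmul_ler. Qed.

Lemma le_qmeetP q S : q <= qmeet S <-> lbound S q.
Proof.
have [lbS geS] := qmeet_infimum S; split=> [le_q x Sx | /geS//].
exact: le_trans le_q (lbS x Sx).
Qed.

Lemma qjoin_leP r S : qjoin S <= r <-> ubound S r.
Proof.
have [ubS leS] := qjoin_isLub S; split=> [le_r x Sx | ]; last exact: leS.
exact: le_trans (ubS x Sx) le_r.
Qed.

End Quantale.

Section FuzzySets.
Context {d : Order.disp_t} {Q : quantaleType d}.
Implicit Types A B : qorderedType Q.

(** Residuation replaces the meet of implications by pointwise inequalities
    between products, the form in which the axioms of fuzzy lower sets and of
    composition apply. *)
Lemma le_fuzzy_subP A (phi psi : A -> Q) (q : Q) :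
  q <= fuzzy_sub phi psi <-> forall x, phi x ⊗ q <= psi x.
Proof.
split=> [/le_qmeetP lbq x | le_psi].
- by apply/qimpP; apply: lbq; exists x.
- by apply/le_qmeetP => _ [x _ <-]; apply/qimpP.
Qed.

Lemma fuzzy_sub_eval A (phi psi : A -> Q) x :
  phi x ⊗ fuzzy_sub phi psi <= psi x.
Proof. exact: (le_fuzzy_subP phi psi _).1. Qed.

Lemma le_fuzzy_image A B (f : A -> B) (phi : A -> Q) x :
  phi x <= fuzzy_image f phi (f x).
Proof.
have [ub _] := qjoin_isLub (range (fun z => phi z ⊗ qhom (f x) (f z))).
by apply: ub; exists x => //; rewrite qhom_refl qmul1.
Qed.

Lemma fuzzy_lower_representable A (a : A) : fuzzy_lower (fun x : A => qhom x a).
Proof. by move=> x y; apply: qhom_trans. Qed.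

(** Direct image is left adjoint to precomposition.  Lowerness of [psi]
    bounds the value of [psi] at a point [y] by its value at [f x] through
    [B(y, f x)]; conversely [f^->(phi)] dominates [phi] along [f]. *)
Lemma fuzzy_sub_image A B (f : A -> B) (phi : A -> Q) (psi : B -> Q) :
  fuzzy_lower psi ->
  fuzzy_sub (fuzzy_image f phi) psi = fuzzy_sub phi (psi \o f).
Proof.
move=> low_psi; apply/le_anti/andP; split; apply/le_fuzzy_subP.
- move=> x; apply: le_trans (fuzzy_sub_eval (fuzzy_image f phi) psi (f x)).
  exact/qmul_lel/le_fuzzy_image.
- move=> y.
  (* Transposing the factor to the right leaves a bare join on the left, which
     can be tested term by term before transposing back. *)
  rewrite qmulC; apply/(qimpP _ _ _).2/qjoin_leP => _ [x _ <-].
  apply/(qimpP _ _ _).1; rewrite qmulA [_ ⊗ phi x]qmulC.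
  apply: le_trans (low_psi y (f x)); apply: qmul_lel.
  exact: (fuzzy_sub_eval phi (psi \o f)).
Qed.

Lemma supremum_ub A (phi : A -> Q) s x :
  is_supremum phi s -> phi x <= qhom x s.
Proof.
move=> sup_s; have := fuzzy_sub_eval phi (fun y => qhom y s) x.
by rewrite -sup_s qhom_refl qmul1.
Qed.

(** Order preserving maps send upper bounds to upper bounds; here this is
    stated already transposed along the adjunction [fuzzy_sub_image]. *)
Lemma supremum_image_ub A B (f : A -> B) (phi : A -> Q) s b :
  q_order_preserving f -> is_supremum phi s ->
  qhom (f s) b <= fuzzy_sub phi (fun x => qhom (f x) b).
Proof.
move=> f_mono sup_s; apply/le_fuzzy_subP => x; rewrite qmulC.
apply: le_trans (qhom_trans (f x) (f s) b); apply: qmul_ler.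
exact: le_trans (supremum_ub x sup_s) (f_mono x s).
Qed.

(** For a representable lower set the closedness inequality is one half of
    the equation that defines a supremum. *)
Lemma closed_fuzzy_representable (Phi : weightClass Q) A (a : A) :
  closed_fuzzy Phi (fun x : A => qhom x a).
Proof.
split; first exact: fuzzy_lower_representable.
by move=> phi s _ ->.
Qed.

End FuzzySets.

Theorem proposition5p7 (d : Order.disp_t) (Q : quantaleType d)
    (Phi : weightClass Q) (A B : qorderedType Q) (f : A -> B) :
  cocontinuous Phi f <->
  (forall phi : B -> Q, closed_fuzzy Phi phi -> closed_fuzzy Phi (phi \o f)).
Proof.
split=> [[f_mono f_sup] psi [low_psi closed_psi] | pre_closed].
  split=> [x y | phi s Phi_phi sup_s].
    exact: le_trans (qmul_ler _ (f_mono x y)) (low_psi (f x) (f y)).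
  rewrite -fuzzy_sub_image //; apply: closed_psi; last exact: f_sup.
  exact: weights_image.
have f_mono : q_order_preserving f.
  move=> x y.
  have [low _] := pre_closed _ (closed_fuzzy_representable Phi (f y)).
  by have := low x y; rewrite /= qhom_refl qmulC qmul1.
split=> // phi s Phi_phi sup_s b.
rewrite fuzzy_sub_image; last exact: fuzzy_lower_representable.
apply/le_anti/andP; split; first exact: supremum_image_ub.
have [_ closed_b] := pre_closed _ (closed_fuzzy_representable Phi b).
exact: closed_b.
Qed.
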